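(* Let $n\ge2$ and let $r=\theta^y$, $s=\theta^z$ be as in the context, with $r\neq s$ and $\gcd\left(y^{n-1}-y^{n-2}z+\cdots+(-1)^{n-1}z^{n-1},\ell\right)=1$. A group-like element $g=\omega_1^{a_1}\cdots\omega_{n-1}^{a_{n-1}}\omega_1'^{\,b_1}\cdots\omega_{n-1}'^{\,b_{n-1}}$ is central in $\mathfrak u_{r,s}(\mathfrak{sl}_n)$ if and only if $$\begin{pmatrix}b_1\\ \vdots\\ b_{n-1}\end{pmatrix}=A^{-1}A^{\mathrm t}\begin{pmatrix}a_1\\ \vdots\\ a_{n-1}\end{pmatrix}\quad\text{in }(\mathbb Z/\ell\mathbb Z)^{n-1}.$$
   Context: $\mathbb K$ is an algebraically closed field of characteristic $0$. Let $n\ge2$, let $r,s\in\mathbb K^\times$ be roots of unity with $r\neq s$, let $\ell$ be the least common multiple of the orders of $r$ and $s$, let $\theta$ be a primitive $\ell$th root of unity, and let $y,z$ be nonnegative integers with $r=\theta^y$, $s=\theta^z$. Let $\epsilon_1,\dots,\epsilon_n$ be an orthonormal basis of a Euclidean space with inner product $\langle\,,\rangle$, and $\alpha_j=\epsilon_j-\epsilon_{j+1}$ for $1\le j<n$. $U=U_{r,s}(\mathfrak{sl}_n)$ is the unital associative $\mathbb K$-algebra generated by $e_j,f_j,\omega_j^{\pm1},(\omega_j')^{\pm1}$ ($1\le j<n$) with relations, for all $1\le i,j<n$ (whenever the indices make sense): (R1) the $\omega_i^{\pm1},(\omega_j')^{\pm1}$ all commute and $\omega_i\omega_i^{-1}=\omega_j'(\omega_j')^{-1}=1$;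 (R2) $\omega_ie_j=r^{\langle\epsilon_i,\alpha_j\rangle}s^{\langle\epsilon_{i+1},\alpha_j\rangle}e_j\omega_i$, $\omega_if_j=r^{-\langle\epsilon_i,\alpha_j\rangle}s^{-\langle\epsilon_{i+1},\alpha_j\rangle}f_j\omega_i$; (R3) $\omega_i'e_j=r^{\langle\epsilon_{i+1},\alpha_j\rangle}s^{\langle\epsilon_i,\alpha_j\rangle}e_j\omega_i'$, $\omega_i'f_j=r^{-\langle\epsilon_{i+1},\alpha_j\rangle}s^{-\langle\epsilon_i,\alpha_j\rangle}f_j\omega_i'$; (R4) $[e_i,f_j]=\frac{\delta_{i,j}}{r-s}(\omega_i-\omega_i')$; (R5) $[e_i,e_j]=[f_i,f_j]=0$ if $|i-j|>1$; (R6) $e_i^2e_{i+1}-(r+s)e_ie_{i+1}e_i+rs\,e_{i+1}e_i^2=0$, $e_ie_{i+1}^2-(r+s)e_{i+1}e_ie_{i+1}+rs\,e_{i+1}^2e_i=0$; (R7) $f_i^2f_{i+1}-(r^{-1}+s^{-1})f_if_{i+1}f_i+r^{-1}s^{-1}f_{i+1}f_i^2=0$, $f_if_{i+1}^2-(r^{-1}+s^{-1})f_{i+1}f_if_{i+1}+r^{-1}s^{-1}f_{i+1}^2f_i=0$. It is a Hopf algebra with $\omega_i,\omega_i'$ group-like, $\Delta(e_i)=e_i\otimes1+\omega_i\otimes e_i$, $\Delta(f_i)=1\otimes f_i+f_i\otimes\omega_i'$, $\epsilon(e_i)=\epsilon(f_i)=0$. Put $\mathcal E_{j,j}=e_j$,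 $\mathcal E_{i,j}=e_i\mathcal E_{i-1,j}-r^{-1}\mathcal E_{i-1,j}e_i$, $\mathcal F_{j,j}=f_j$, $\mathcal F_{i,j}=f_i\mathcal F_{i-1,j}-s\mathcal F_{i-1,j}f_i$ ($i>j$). The restricted two-parameter quantum group $\mathfrak u_{r,s}(\mathfrak{sl}_n)$ is the (finite-dimensional) Hopf algebra quotient of $U$ by the ideal generated by all $\mathcal E_{i,j}^\ell,\mathcal F_{i,j}^\ell,\omega_i^\ell-1,(\omega_i')^\ell-1$ ($1\le j\le i<n$). Its group of group-like elements is generated by the $\omega_i,\omega_i'$. $A$ is the $(n-1)\times(n-1)$ tridiagonal matrix with $A_{i,i}=y-z$, $A_{i,i+1}=z$, $A_{i+1,i}=-y$ and all other entries $0$. Its determinant is $y^{n-1}-y^{n-2}z+\cdots+(-1)^{n-1}z^{n-1}$, so under the gcd assumption $A$ is invertible modulo $\ell$; $A^{\mathrm t}$ is its transpose. *)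

(* Defs.v *)
From HB Require Import structures.
From mathcomp Require Import all_boot all_algebra.
From mathcomp Require Import boolp.
From mathcomp.multinomials Require Import monalg.

Set Implicit Arguments.
Unset Strict Implicit.
Unset Printing Implicit Defensive.

Import GRing.Theory.
Local Open Scope ring_scope.
Local Open Scope quotient_scope.

(* Unital associative K-algebras, as rings A with a ring morphism from K to the
   center of A. Unlike in MathComp's algType, 1 = 0 is not excluded: an algebra
   given by generators and relations is not known to be nonzero in advance. *)
HB.mixin Record hasScalars (K : pzRingType) A of GRing.PzRing A := {
  scal : K -> A;
  scal_zmod_morphism : zmod_morphism scal;
  scal_monoid_morphism : monoid_morphism scal;
  scalC : forall (c : K) (x : A), scal c * x = x * scal c
}.

#[short(type="pzAlgType")]
HB.structure Definition PzAlgebra (K : pzRingType) :=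
  {A of GRing.PzRing A & hasScalars K A}.

Notation "c %:S" := (@scal _ _ c) (at level 2, left associativity) : ring_scope.

HB.instance Definition _ (K : pzRingType) (A : pzAlgType K) :=
  GRing.isZmodMorphism.Build K A (@scal K A) (@scal_zmod_morphism K A).
HB.instance Definition _ (K : pzRingType) (A : pzAlgType K) :=
  GRing.isMonoidMorphism.Build K A (@scal K A) (@scal_monoid_morphism K A).

(* Finite K-linear combinations of words in the letters X. *)
Section FreeAlgebra.
Variables (K : comNzRingType) (X : choiceType).

Definition freealg : Type := {malg K[{fmonom X}]}.

HB.instance Definition _ := GRing.NzRing.on freealg.

Definition freegen (x : X) : freealg := mkmalgU (fmu x) 1.

Definition freescal (c : K) : freealg := malgC c.

Lemma freescal_zmod_morphism : zmod_morphism freescal.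
Proof. exact: (@raddfB _ _ (@malgC {fmonom X} K)). Qed.

Lemma freescal_monoid_morphism : monoid_morphism freescal.
Proof.
by split; [exact: (@mpolyC1E {fmonom X} K) | exact: (@mpolyCM {fmonom X} K)].
Qed.

Lemma freescalC (c : K) (x : freealg) : freescal c * x = x * freescal c.
Proof.
rewrite [LHS](@malgM_def {fmonom X} K) [RHS](@malgM_def {fmonom X} K).
rewrite fgmulUg fgmulgU; apply: eq_bigr => k _.
by rewrite mul1m mulm1 mulrC.
Qed.

HB.instance Definition _ := hasScalars.Build K freealg
  freescal_zmod_morphism freescal_monoid_morphism freescalC.
End FreeAlgebra.

(* The two-sided ideal generated by all x - y with rel x y. *)
Inductive ideal_gen (A : pzRingType) (rel : A -> A -> Prop) : A -> Prop :=
| ideal_rel x y of rel x y : ideal_gen rel (x - y)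
| ideal_zero : ideal_gen rel 0
| ideal_add x y of ideal_gen rel x & ideal_gen rel y : ideal_gen rel (x + y)
| ideal_mull a x of ideal_gen rel x : ideal_gen rel (a * x)
| ideal_mulr x a of ideal_gen rel x : ideal_gen rel (x * a).

Section Quotient.
Variables (K : pzRingType) (A : pzAlgType K) (rel : A -> A -> Prop).

Definition ideal_pred : {pred A} := fun x => `[< ideal_gen rel x >].

Lemma ideal_predP x : reflect (ideal_gen rel x) (x \in ideal_pred).
Proof. exact: asboolP. Qed.

Lemma ideal_zmod_closed : zmod_closed ideal_pred.
Proof.
split=> [|x y /ideal_predP Ix /ideal_predP Iy]; apply/ideal_predP.
  exact: ideal_zero.
by rewrite -mulN1r; apply: ideal_add => //; apply: ideal_mull.
Qed.

HB.instance Definition _ :=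
  GRing.isZmodClosed.Build A ideal_pred ideal_zmod_closed.

Definition quotalg : Type := Quotient.quot (ideal_pred : zmodClosed A).

HB.instance Definition _ := GRing.Zmodule.on quotalg.
HB.instance Definition _ : EqQuotient A (Quotient.equiv ideal_pred) quotalg :=
  EqQuotient.on quotalg.

Definition quotpi (x : A) : quotalg := \pi_(Quotient.quot ideal_pred) x.

Lemma quotpiP x y : ideal_gen rel (x - y) <-> quotpi x = quotpi y.
Proof.
split=> [/ideal_predP | /eqP]; first by rewrite Quotient.idealrBE => /eqP.
by rewrite -Quotient.idealrBE => /ideal_predP.
Qed.

Lemma quotpi_repr (x : quotalg) :
  quotpi (repr (x : Quotient.quot ideal_pred)) = x.
Proof. exact: reprK. Qed.

Lemma quotpiB : {morph quotpi : x y / x - y}.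
Proof. exact: (raddfB (\pi_(Quotient.quot (ideal_pred : zmodClosed A)))). Qed.

Lemma quotpiD : {morph quotpi : x y / x + y}.
Proof. exact: (raddfD (\pi_(Quotient.quot (ideal_pred : zmodClosed A)))). Qed.

Definition quot_one : quotalg := quotpi 1.
Definition quot_mul (x y : quotalg) : quotalg :=
  quotpi (repr (x : Quotient.quot ideal_pred)
          * repr (y : Quotient.quot ideal_pred)).

Lemma quotpi_reprB (x : A) :
  ideal_gen rel (repr (quotpi x : Quotient.quot ideal_pred) - x).
Proof. by apply/quotpiP; rewrite quotpi_repr. Qed.

Lemma quotpi_mul x y : quot_mul (quotpi x) (quotpi y) = quotpi (x * y).
Proof.
apply/quotpiP; set x' := repr _; set y' := repr _.
have -> : x' * y' - x * y = (x' - x) * y' + x * (y' - y).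
  by rewrite mulrBl mulrBr addrA subrK.
by apply: ideal_add; [apply: ideal_mulr | apply: ideal_mull];
  apply: quotpi_reprB.
Qed.

Let surj (P : quotalg -> Prop) : (forall x, P (quotpi x)) -> forall x, P x.
Proof. by move=> h x; rewrite -(quotpi_repr x). Qed.

Lemma quot_mulA : associative quot_mul.
Proof. by do 3![elim/surj => ?]; rewrite !quotpi_mul mulrA. Qed.
Lemma quot_mul1 : left_id quot_one quot_mul.
Proof. by elim/surj => ?; rewrite quotpi_mul mul1r. Qed.
Lemma quot_mulr1 : right_id quot_one quot_mul.
Proof. by elim/surj => ?; rewrite quotpi_mul mulr1. Qed.
Lemma quot_mulDl : left_distributive quot_mul +%R.
Proof.
by do 3![elim/surj => ?]; rewrite -quotpiD !quotpi_mul -quotpiD mulrDl.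
Qed.
Lemma quot_mulDr : right_distributive quot_mul +%R.
Proof.
by do 3![elim/surj => ?]; rewrite -quotpiD !quotpi_mul -quotpiD mulrDr.
Qed.

HB.instance Definition _ := GRing.Zmodule_isPzRing.Build quotalg
  quot_mulA quot_mul1 quot_mulr1 quot_mulDl quot_mulDr.

Lemma quotpi_is_monoid_morphism : monoid_morphism quotpi.
Proof. by split=> // x y; rewrite -quotpi_mul. Qed.

HB.instance Definition _ := GRing.isZmodMorphism.Build A quotalg quotpi quotpiB.
HB.instance Definition _ :=
  GRing.isMonoidMorphism.Build A quotalg quotpi quotpi_is_monoid_morphism.

Definition quot_scal (c : K) : quotalg := quotpi c%:S.

Lemma quot_scal_zmod_morphism : zmod_morphism quot_scal.
Proof. by move=> c d; rewrite /quot_scal !rmorphB. Qed.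

Lemma quot_scal_monoid_morphism : monoid_morphism quot_scal.
Proof. by split=> [|c d]; rewrite /quot_scal ?rmorph1 ?rmorphM. Qed.

Lemma quot_scalC (c : K) (x : quotalg) : quot_scal c * x = x * quot_scal c.
Proof. by elim/surj: x => x; rewrite -!rmorphM scalC. Qed.

HB.instance Definition _ := hasScalars.Build K quotalg
  quot_scal_zmod_morphism quot_scal_monoid_morphism quot_scalC.
End Quotient.

(* Indices are shifted to start at 0: with m = n - 1, the index i : 'I_m stands
   for i + 1 in 1, ..., n - 1. GWi and GW'i are the formal inverses of the
   generators GW (omega) and GW' (omega'). *)
Variant qgen (m : nat) :=
  | GE of 'I_m | GF of 'I_m
  | GW of 'I_m | GWi of 'I_m | GW' of 'I_m | GW'i of 'I_m.

Section QgenChoice.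
Variable m : nat.

Definition qgen_code (x : qgen m) : nat * 'I_m :=
  match x with
  | GE i => (0, i) | GF i => (1, i) | GW i => (2, i)
  | GWi i => (3, i) | GW' i => (4, i) | GW'i i => (5, i)
  end.

Definition qgen_decode (p : nat * 'I_m) : qgen m :=
  match p.1 with
  | 0 => GE p.2 | 1 => GF p.2 | 2 => GW p.2
  | 3 => GWi p.2 | 4 => GW' p.2 | _ => GW'i p.2
  end.

Lemma qgen_codeK : cancel qgen_code qgen_decode.
Proof. by case. Qed.

HB.instance Definition _ := Choice.copy (qgen m) (can_type qgen_codeK).
End QgenChoice.

Definition toral m (x : qgen m) : bool :=
  match x with GE _ | GF _ => false | _ => true end.

(* <epsilon_i, alpha_j> = <epsilon_i, epsilon_j - epsilon_{j+1}>, for an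
   orthonormal family epsilon. *)
Definition eps_alpha (i j : nat) : int := (i == j)%:Z - (i == j.+1)%:Z.

Section QuantumGroup.
Variables (K : fieldType) (n : nat) (r s : K).

Notation m := n.-1.
Notation Fr := (freealg K (qgen m)).
Notation e i := (freegen K (GE i)).
Notation f i := (freegen K (GF i)).
Notation w i := (freegen K (GW i)).
Notation wi i := (freegen K (GWi i)).
Notation w' i := (freegen K (GW' i)).
Notation w'i i := (freegen K (GW'i i)).

Inductive Urel : Fr -> Fr -> Prop :=
| R1_comm (x y : qgen m) of toral x & toral y :
    Urel (freegen K x * freegen K y) (freegen K y * freegen K x)
| R1_inv (i : 'I_m) : Urel (w i * wi i) 1
| R1_inv' (i : 'I_m) : Urel (w' i * w'i i) 1
| R2_e (i j : 'I_m) :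
    Urel (w i * e j)
         ((r ^ eps_alpha i j * s ^ eps_alpha i.+1 j)%:S * (e j * w i))
| R2_f (i j : 'I_m) :
    Urel (w i * f j)
         ((r ^ (- eps_alpha i j) * s ^ (- eps_alpha i.+1 j))%:S * (f j * w i))
| R3_e (i j : 'I_m) :
    Urel (w' i * e j)
         ((r ^ eps_alpha i.+1 j * s ^ eps_alpha i j)%:S * (e j * w' i))
| R3_f (i j : 'I_m) :
    Urel (w' i * f j)
         ((r ^ (- eps_alpha i.+1 j) * s ^ (- eps_alpha i j))%:S * (f j * w' i))
| R4 (i j : 'I_m) :
    Urel (e i * f j - f j * e i) (((i == j)%:R / (r - s))%:S * (w i - w' i))
| R5_e (i j : 'I_m) of (i.+1 < j)%N || (j.+1 < i)%N :
    Urel (e i * e j - e j * e i) 0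
| R5_f (i j : 'I_m) of (i.+1 < j)%N || (j.+1 < i)%N :
    Urel (f i * f j - f j * f i) 0
| R6_l (i j : 'I_m) of j = i.+1 :> nat :
    Urel (e i ^+ 2 * e j - (r + s)%:S * (e i * e j * e i)
          + (r * s)%:S * (e j * e i ^+ 2)) 0
| R6_r (i j : 'I_m) of j = i.+1 :> nat :
    Urel (e i * e j ^+ 2 - (r + s)%:S * (e j * e i * e j)
          + (r * s)%:S * (e j ^+ 2 * e i)) 0
| R7_l (i j : 'I_m) of j = i.+1 :> nat :
    Urel (f i ^+ 2 * f j - (r^-1 + s^-1)%:S * (f i * f j * f i)
          + (r^-1 * s^-1)%:S * (f j * f i ^+ 2)) 0
| R7_r (i j : 'I_m) of j = i.+1 :> nat :
    Urel (f i * f j ^+ 2 - (r^-1 + s^-1)%:S * (f j * f i * f j)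
          + (r^-1 * s^-1)%:S * (f j ^+ 2 * f i)) 0.

(* U_{r,s}(sl_n) *)
Definition Urs : pzAlgType K := quotalg Urel.

Definition Ugen (x : qgen m) : Urs := quotpi Urel (freegen K x).

(* e_k and f_k in Urs for a natural number k, 0 (a junk value) when k >= n - 1 *)
Definition Ue (k : nat) : Urs := oapp (fun i => Ugen (GE i)) 0 (insub k).
Definition Uf (k : nat) : Urs := oapp (fun i => Ugen (GF i)) 0 (insub k).

(* meaningful for j <= i < n - 1 only *)
Fixpoint calE (i j : nat) : Urs :=
  if i is k.+1 then
    if (j <= k)%N then Ue i * calE k j - (r^-1)%:S * (calE k j * Ue i) else Ue j
  else Ue j.

Fixpoint calF (i j : nat) : Urs :=
  if i is k.+1 then
    if (j <= k)%N then Uf i * calF k j - s%:S * (calF k j * Uf i) else Uf j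
  else Uf j.

Variable l : nat.

Inductive urel : Urs -> Urs -> Prop :=
| urel_E (i j : 'I_m) of (j <= i)%N : urel (calE i j ^+ l) 0
| urel_F (i j : 'I_m) of (j <= i)%N : urel (calF i j ^+ l) 0
| urel_w (i : 'I_m) : urel (Ugen (GW i) ^+ l) 1
| urel_w' (i : 'I_m) : urel (Ugen (GW' i) ^+ l) 1.

(* the restricted two-parameter quantum group u_{r,s}(sl_n) *)
Definition urs : pzAlgType K := quotalg urel.

Definition ugen (x : qgen m) : urs := quotpi urel (Ugen x).

(* x^a for an integer a, where xi is the inverse of x *)
Definition intpow (x xi : urs) (a : int) : urs :=
  match a with Posz k => x ^+ k | Negz k => xi ^+ k.+1 end.

Definition grouplike (a b : 'cV[int]_m) : urs :=
  (\prod_(i < m) intpow (ugen (GW i)) (ugen (GWi i)) (a i 0))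
  * (\prod_(i < m) intpow (ugen (GW' i)) (ugen (GW'i i)) (b i 0)).
End QuantumGroup.

Definition central (A : pzRingType) (x : A) : Prop := forall y, GRing.comm x y.

Definition tridiag (m : nat) (y z : int) : 'M[int]_m :=
  \matrix_(i, j) if i == j then y - z
                 else if j == i.+1 :> nat then z
                 else if i == j.+1 :> nat then - y
                 else 0.

(* Main.v *)
From HB Require Import structures.
Require Import Defs.
From mathcomp.multinomials Require Import monalg.
From mathcomp Require Import all_boot all_algebra ring zify.

(** Let g be the group-like element with exponents a, b. It commutes with every
    omega and omega', and with e_k and f_k up to a scalar:
    g e_k = theta^d_k e_k g and g f_k = theta^(-d_k) f_k g, where
    d = A^t a - A b. Indeed the exponents of
    theta in the scalars by which omega_i and omega'_i commute with e_k are
    A_{i,k} and - A_{k,i} ([eps_alpha_tridiag], [eps_alpha_tridiag_trans]).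
    Thus d = 0 modulo l makes g commute with all generators, hence central.

    Conversely, if g is central then (1 - theta^d_k) e_k g = 0, and as g is
    invertible, theta^d_k = 1 as soon as e_k is nonzero in the restricted
    quantum group ([central_grouplikeP]). An algebra given by generators and
    relations could collapse, so e_k <> 0 needs a representation; the natural
    one on K^n is enough ([ugen_GE_neq0]): e_j, f_j act by the matrix units
    E_{j,j+1}, E_{j+1,j}, and omega_j, omega'_j by diagonal matrices with
    entries r, s, respectively s, r, in the places j, j+1. The root vectors act
    by multiples of off-diagonal matrix units, which have square 0, and l > 1
    because r <> s.

    So g is central iff A^t a = A b modulo l. Expanding along the first row
    gives det A = y^(n-1) - y^(n-2) z + ... ([det_tridiag]), a unit modulo l by
    the gcd assumption, so that this is b = A^-1 A^t a. *)

Set Implicit Arguments.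
Unset Strict Implicit.
Unset Printing Implicit Defensive.

Import GRing.Theory.
Local Open Scope ring_scope.

(** * Free algebras and quotients *)

Lemma freealg_ind (K : comNzRingType) (X : choiceType)
    (P : freealg K X -> Prop) :
  (forall c, P c%:S) -> (forall x, P (freegen K x)) ->
  (forall u v, P u -> P v -> P (u + v)) ->
  (forall u v, P u -> P v -> P (u * v)) -> forall u, P u.
Proof.
move=> Pc Px PD PM u.
have malgUM c1 c2 k1 k2 :
    << c1 *g k1 >> * << c2 *g k2 >> = << c1 * c2 *g mmul k1 k2 >>
      :> freealg K X.
  by rewrite [LHS](@malgM_def {fmonom X} K) fgmulUU.
have Pword (t : seq X) : P << 1 *g FMonom t >>.
  elim: t => [|x t IH]; first by rewrite -fmoneE; apply: (Pc 1).
  have -> : FMonom (x :: t) = fmmul (fmu x) (FMonom t).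
    by rewrite fmmulE fmuE.
  rewrite -[1](mulr1 1) -malgUM.
  exact: PM (Px x) IH.
rewrite [u]monalgE; elim/big_ind: _ => // [|k _].
  by have := Pc 0; rewrite rmorph0.
have -> : << u@_k *g k >> = (u@_k)%:S * (<< 1 *g k >> : freealg K X).
  by rewrite malgUM mul1m mulr1.
by apply: PM => //; rewrite -(fmK k).
Qed.

(** The universal property of the free algebra. The target carries its scalars
    through f only, so that square matrices can be used with f the map to
    scalar matrices. *)
Lemma freealg_lift (K : comNzRingType) (X : choiceType) (S : nzRingType)
    (f : {rmorphism K -> S}) (h : X -> S) :
  (forall c u, GRing.comm (f c) u) ->
  exists phi : {rmorphism freealg K X -> S},
    (forall c, phi c%:S = f c) /\ (forall x, phi (freegen K x) = h x).
Proof.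
move=> fC; pose hm (k : {fmonom X}) : S := \prod_(x <- (k : seq X)) h x.
have hm_morph : mmorphism hm.
  split=> [k1 k2|]; rewrite /hm ?fm1 ?big_nil //.
  by rewrite fmM big_cat.
pose mixW := monalg.isMultiplicative.Build _ _ hm hm_morph.
pose hM : MMorphism.type {fmonom X} S := HB.pack hm mixW.
pose F : freealg K X -> S := mmap f hM.
have FM : monoid_morphism F.
  by have [] := @commr_mmap_is_multiplicative _ K S f hM
    (fun g k k' => fC g@_k (hM k')).
have FA : zmod_morphism F by exact: mmap_is_additive.
pose mixA := GRing.isZmodMorphism.Build _ _ F FA.
pose mixM := GRing.isMonoidMorphism.Build _ _ F FM.
pose phi : {rmorphism freealg K X -> S} := HB.pack F mixA mixM.
exists phi; split=> [c|x] /=.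
  exact: mmapC.
transitivity (f 1 * hm (fmu x)); first exact: mmapU.
by rewrite rmorph1 mul1r /hm fmuE big_seq1.
Qed.

Lemma quotalg_lift (K : pzRingType) (A : pzAlgType K) (rel : A -> A -> Prop)
    (S : pzRingType) (phi : {rmorphism A -> S}) :
  (forall u v, rel u v -> phi u = phi v) ->
  exists psi : {rmorphism quotalg rel -> S},
    forall u, psi (quotpi rel u) = phi u.
Proof.
move=> phi_rel.
have phi0 u : ideal_gen rel u -> phi u = 0.
  elim=> {u} [u v /phi_rel uv|| u v _ Pu _ Pv | v u _ Pu | u v _ Pu].
  - by rewrite rmorphB uv subrr.
  - exact: rmorph0.
  - by rewrite rmorphD Pu Pv addr0.
  - by rewrite rmorphM Pu mulr0.
  - by rewrite rmorphM Pu mul0r.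
pose F (q : quotalg rel) := phi (repr (q : Quotient.quot (ideal_pred rel))).
have FE u : F (quotpi rel u) = phi u.
  by apply/eqP; rewrite -subr_eq0 -rmorphB; apply/eqP/phi0/quotpi_reprB.
have surj (P : quotalg rel -> Prop) :
    (forall u, P (quotpi rel u)) -> forall q, P q.
  by move=> h q; rewrite -(quotpi_repr q).
have F_zmod : zmod_morphism F.
  by do 2![elim/surj=> ?]; rewrite -rmorphB !FE rmorphB.
have F_monoid : monoid_morphism F.
  split=> [|]; first by rewrite -(rmorph1 (quotpi rel)) FE rmorph1.
  by do 2![elim/surj=> ?]; rewrite -rmorphM !FE rmorphM.
pose mixA := GRing.isZmodMorphism.Build _ _ F F_zmod.
pose mixM := GRing.isMonoidMorphism.Build _ _ F F_monoid.
pose psi : {rmorphism quotalg rel -> S} := HB.pack F mixA mixM.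
by exists psi.
Qed.

(** * Invertible elements and commutation up to a scalar *)

Lemma expr_inv (R : pzRingType) (x xi : R) k :
  x * xi = 1 -> xi * x = 1 -> x ^+ k * xi ^+ k = 1.
Proof.
by move=> xxi xix; rewrite -exprMn_comm ?xxi ?expr1n // /GRing.comm xxi xix.
Qed.

Definition invertible (R : pzRingType) (g : R) :=
  exists h, h * g = 1 /\ g * h = 1.

Lemma invertibleM (R : pzRingType) (g1 g2 : R) :
  invertible g1 -> invertible g2 -> invertible (g1 * g2).
Proof.
move=> [h1 [hg1 gh1]] [h2 [hg2 gh2]]; exists (h2 * h1); split.
  by rewrite mulrA -(mulrA h2) hg1 mulr1.
by rewrite mulrA -(mulrA g1) gh2 mulr1.
Qed.

Lemma invertible_prod (R : pzRingType) (I : Type) (t : seq I) (g : I -> R) :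
  (forall i, invertible (g i)) -> invertible (\prod_(i <- t) g i).
Proof.
move=> gV; elim/big_ind: _ => //; first by exists 1; rewrite mulr1.
exact: invertibleM.
Qed.

Section SkewCommutation.
Variables (K : fieldType) (A : pzAlgType K).
Implicit Types (c d : K) (g h u : A).

Definition qcomm c g u := g * u = c%:S * (u * g).

Lemma qcomm_one u : qcomm 1 1 u.
Proof. by rewrite /qcomm rmorph1 !mul1r mulr1. Qed.

Lemma qcommM c d g h u : qcomm c g u -> qcomm d h u -> qcomm (c * d) (g * h) u.
Proof.
rewrite /qcomm => gu hu.
rewrite -mulrA hu mulrA -scalC -mulrA (mulrA g) gu.
by rewrite !mulrA -rmorphM [d * c]mulrC.
Qed.

Lemma qcommX c g u k : qcomm c g u -> qcomm (c ^+ k) (g ^+ k) u.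
Proof.
move=> gu; elim: k => [|k IH]; first exact: qcomm_one.
by rewrite !exprS; apply: qcommM.
Qed.

(** The scalar of an inverse is found by multiplying g u = c u g by the inverse
    of g on both sides. *)
Lemma qcommV c g gi u :
  c != 0 -> g * gi = 1 -> gi * g = 1 -> qcomm c g u -> qcomm c^-1 gi u.
Proof.
rewrite /qcomm => c0 ggi gig gu.
have -> : u * gi = gi * (g * u) * gi by rewrite mulrA gig mul1r.
rewrite gu !mulrA -(scalC c) !mulrA -rmorphM mulfV // rmorph1 mul1r.
by rewrite -!mulrA ggi mulr1.
Qed.

Lemma qcomm_prod (I : Type) (t : seq I) (c : I -> K) (g : I -> A) u :
  (forall i, qcomm (c i) (g i) u) ->
  qcomm (\prod_(i <- t) c i) (\prod_(i <- t) g i) u.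
Proof.
move=> gu; elim: t => [|i t IH]; first by rewrite !big_nil; apply: qcomm_one.
by rewrite !big_cons; apply: qcommM.
Qed.

Lemma qcomm1_comm g u : qcomm 1 g u -> GRing.comm g u.
Proof. by rewrite /qcomm rmorph1 mul1r. Qed.

(** Both commutations give (1 - c) u g = 0, where 1 - c and g can be
    cancelled. *)
Lemma qcomm_comm_eq0 c g u :
  qcomm c g u -> GRing.comm g u -> invertible g -> c != 1 -> u = 0.
Proof.
move=> gu cgu [h [_ gh]] c1.
have ug0 : u * g = 0.
  have d0 : (1 - c)%:S * (u * g) = 0.
    by rewrite rmorphB rmorph1 mulrBl mul1r -gu cgu subrr.
  have c1' : 1 - c != 0 by rewrite subr_eq0 eq_sym.
  by rewrite -[u * g]mul1r -(rmorph1 scal) -(mulVf c1') rmorphM -mulrA d0 mulr0.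
by rewrite -[u]mulr1 -gh mulrA ug0 mul0r.
Qed.
End SkewCommutation.

(** * Exponents modulo l and the tridiagonal matrix *)

Lemma prod_exprz (K : fieldType) (x : K) (I : Type) (t : seq I) (d : I -> int) :
  x != 0 -> \prod_(i <- t) x ^ d i = x ^ (\sum_(i <- t) d i).
Proof.
move=> x0; elim: t => [|i t IH]; first by rewrite !big_nil.
by rewrite !big_cons IH expfzDr.
Qed.

Lemma prim_exprz_eq1 (K : fieldType) (l : nat) (theta : K) (d : int) :
  l.-primitive_root theta -> (1 < l)%N ->
  (theta ^ d == 1) = (d%:~R == 0 :> 'Z_l).
Proof.
move=> th l1.
have E (k : nat) : (theta ^+ k == 1) = (k%:R == 0 :> 'Z_l).
  by rewrite -(prim_order_dvd th) -val_eqE /= val_Zp_nat.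
case: d => k; first exact: E.
rewrite NegzE -invr_expz -[1 in LHS]invr1 (can_eq (@invrK _)) E.
by rewrite rmorphN oppr_eq0.
Qed.

Section Tridiagonal.
Variables y z : int.

Lemma tridiag_minor m :
  row' ord0 (col' ord0 (tridiag m.+1 y z)) = tridiag m y z.
Proof. by apply/matrixP=> i j; rewrite !mxE /= !eqSS. Qed.

(** In the expansion along the first row, the minor of the entry z has -y as the
    only nonzero entry of its first column. *)
Lemma det_tridiagSS m :
  \det (tridiag m.+2 y z)
    = (y - z) * \det (tridiag m.+1 y z) + y * z * \det (tridiag m y z).
Proof.
rewrite (expand_det_row _ ord0) !big_ord_recl big1 ?addr0 => [|i _]; last first.
  by rewrite !mxE mul0r.
rewrite !mxE /= /cofactor tridiag_minor expr0 mul1r; congr (_ + _).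
rewrite (expand_det_col _ ord0) big_ord_recl big1 ?addr0 => [|i _]; last first.
  by rewrite !mxE mul0r.
rewrite !mxE /= /cofactor.
set B := row' _ _; have -> : B = tridiag m y z.
  by apply/matrixP=> i j; rewrite !mxE /= !eqSS.
by rewrite /bump /= expr0 expr1; ring.
Qed.

(** By the two-term recurrence, D_(m+2) - y D_(m+1) = - z (D_(m+1) - y D_m) for
    the determinants D, so these differences are the powers of -z. *)
Lemma det_tridiagS m :
  \det (tridiag m.+1 y z) = y * \det (tridiag m y z) + (- z) ^+ m.+1.
Proof.
elim: m => [|m IH].
  rewrite (mx11_scalar (tridiag 1 y z)) det_scalar1 !mxE det_mx00 /=.
  by rewrite mulr1 expr1.
by rewrite det_tridiagSS (exprS _ m.+1) IH; ring.
Qed.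

Lemma det_tridiag m :
  \det (tridiag m y z) = \sum_(i < m.+1) (-1) ^+ i * y ^+ (m - i) * z ^+ i.
Proof.
elim: m => [|m IH].
  by rewrite det_mx00 big_ord_recl big_ord0 !mulr1 addr0.
rewrite det_tridiagS IH [RHS]big_ord_recr /= subnn mulr1 -exprNn; congr (_ + _).
rewrite mulr_sumr; apply: eq_bigr => i _.
by rewrite subSn -1?ltnS //= exprS; ring.
Qed.
End Tridiagonal.

(** Bezout coefficients of the determinant and l give an inverse of the
    determinant modulo l. *)
Lemma tridiag_unitmx (m l : nat) (y z : int) : (1 < l)%N ->
  gcdz (\sum_(i < m.+1) (-1) ^+ i * y ^+ (m - i) * z ^+ i) l%:Z = 1 ->
  (map_mx intr (tridiag m y z) : 'M['Z_l]_m) \in unitmx.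
Proof.
move=> l1; rewrite -det_tridiag => gcd1.
have /coprimezP[[u v] /= uv] : coprimez (\det (tridiag m y z)) l%:Z.
  by rewrite /coprimez gcd1.
rewrite unitmxE det_map_mx; apply/unitrPr; exists u%:~R.
have := congr1 (intr : int -> 'Z_l) uv.
by rewrite rmorphD !rmorphM /= [l%:~R]pchar_Zp // mulr0 addr0 mulrC.
Qed.

(** The left side is the exponent of theta in
    r^<eps_i, alpha_k> s^<eps_(i+1), alpha_k>, by which omega_i commutes with
    e_k. *)
Lemma eps_alpha_tridiag (m : nat) (i k : 'I_m) (y z : int) :
  y * eps_alpha i k + z * eps_alpha i.+1 k = tridiag m y z i k.
Proof.
rewrite /eps_alpha mxE eqSS -val_eqE /= [k == i.+1 :> nat]eq_sym.
case: (eqVneq (i : nat) k) => [->|ik].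
  rewrite -[_ == _.+1]negbK -[_.+1 == _]negbK !neq_ltn !ltnS !leqnn ?orbT /=.
  by ring.
case: (eqVneq i.+1 (k : nat)) => [<-|ik']; last by case: eqP => _ /=; ring.
by rewrite -[_ == _.+2]negbK neq_ltn ltnS leqnSn /=; ring.
Qed.

(** For omega'_i the roles of eps_i and eps_(i+1) are exchanged; as
    <eps_(i+1), alpha_k> = - <eps_k, alpha_i>, this transposes and negates. *)
Lemma eps_alpha_tridiag_trans (m : nat) (i k : 'I_m) (y z : int) :
  y * eps_alpha i.+1 k + z * eps_alpha i k = - tridiag m y z k i.
Proof.
rewrite -eps_alpha_tridiag /eps_alpha !eqSS.
rewrite [k == i :> nat]eq_sym [k == i.+1 :> nat]eq_sym.
by rewrite [k.+1 == i :> nat]eq_sym; ring.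
Qed.

(** * Matrices of the natural representation *)

Section NaturalRepresentation.
Variables (K : fieldType) (p : nat).
Notation M := 'M[K]_p.+2.

(** Natural numbers as indices, so that the places i and i + 1 of a matrix of
    size n can both be named from an index i < n - 1; out of range, [inord]
    falls back to 0, whence the bounds assumed in [matunitM]. *)
Definition matunit (i j : nat) : M := delta_mx (inord i) (inord j).

(** The diagonal matrix with u and v in the places i and i + 1 and 1 elsewhere.
    Writing the entries as powers lets [expr_eps] match them with the exponents
    <eps_i, alpha_j> of the defining relations without cases on i and j. *)
Definition twodiag (i : nat) (u v : K) : M :=
  diag_mx (\row_k (u ^+ (k == i :> nat) * v ^+ (k == i.+1 :> nat))).

Lemma matunitM i j k h : (j < p.+2)%N -> (k < p.+2)%N ->
  matunit i j * matunit k h = matunit i h *+ (j == k).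
Proof.
move=> jp kp; rewrite [LHS]mul_delta_mx_cond.
by rewrite -val_eqE /= !inordK.
Qed.

Lemma matunitM0 i j k h : (j < p.+2)%N -> (k < p.+2)%N -> j != k ->
  matunit i j * matunit k h = 0.
Proof. by move=> jp kp /negPf jk; rewrite matunitM // jk. Qed.

Lemma matunit_neq0 i j : matunit i j != 0.
Proof.
apply/eqP => /matrixP /(_ (inord i) (inord j)) /eqP.
by rewrite !mxE !eqxx oner_eq0.
Qed.

Lemma twodiagM i u v u' v' :
  twodiag i u v * twodiag i u' v' = twodiag i (u * u') (v * v').
Proof.
rewrite [LHS]mulmx_diag; congr diag_mx; apply/rowP=> k.
by rewrite !mxE !exprMn; ring.
Qed.

Lemma twodiag11 i : twodiag i 1 1 = 1.
Proof.
rewrite -[RHS]diag_const_mx; congr diag_mx; apply/rowP=> k.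
by rewrite !mxE !expr1n mulr1.
Qed.

Lemma twodiagX i u v k : twodiag i u v ^+ k = twodiag i (u ^+ k) (v ^+ k).
Proof. by elim: k => [|k IH]; rewrite ?twodiag11 // !exprS IH twodiagM. Qed.

Lemma twodiagC i j u v u' v' :
  twodiag i u v * twodiag j u' v' = twodiag j u' v' * twodiag i u v.
Proof. exact: diag_mxC. Qed.

Lemma twodiag_sub i (u v : K) : (i < p.+1)%N ->
  twodiag i u v - twodiag i v u
    = (u - v)%:M * (matunit i i - matunit i.+1 i.+1).
Proof.
move=> ip; rewrite -[RHS]/(_ *m _) mul_scalar_mx; apply/matrixP=> a b.
rewrite !mxE -!val_eqE /= !inordK //; last by rewrite ltnW.
have [ab|ab] := eqVneq (a : nat) b; last first.
  have nab k : (a == k :> nat) && (b == k :> nat) = false.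
    by apply/negP => /andP[/eqP <- /eqP ba]; rewrite ba eqxx in ab.
  by rewrite !nab !mulr0n !subrr mulr0.
rewrite -ab !andbb !mulr1n.
have [->|_] := eqVneq (a : nat) i.
  by rewrite ltn_eqF //= !expr0 !expr1; ring.
by case: eqVneq => _ /=; rewrite ?expr0 ?expr1; ring.
Qed.

(** Conjugating E_{a,b} by a diagonal matrix multiplies it by the quotient of
    the entries a and b of that matrix. *)
Lemma twodiag_matunit i u v a b c :
  (a < p.+2)%N -> (b < p.+2)%N ->
  u ^+ (a == i) * v ^+ (a == i.+1) = c * (u ^+ (b == i) * v ^+ (b == i.+1)) ->
  twodiag i u v * matunit a b = c%:M * (matunit a b * twodiag i u v).
Proof.
move=> ap bp uv; rewrite -[RHS]/(_ *m _) mul_scalar_mx.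
rewrite -[LHS]/(_ *m _) -[X in _ *: X]/(_ *m _) mul_diag_mx mul_mx_diag.
apply/matrixP=> g h; rewrite !mxE.
case: (eqVneq g) => [->|_]; last by rewrite !mulr0 mul0r mulr0.
case: (eqVneq h) => [->|_]; last by rewrite !mulr0 mul0r mulr0.
by rewrite !inordK //= mulr1 mul1r uv.
Qed.

Lemma expr_eps (u : K) i j : u != 0 ->
  u ^+ (j == i) = u ^ eps_alpha i j * u ^+ (j.+1 == i).
Proof.
move=> u0; rewrite /eps_alpha ![_ == i]eq_sym.
by rewrite !exprnP -expfzDr // subrK.
Qed.

Lemma twodiag_E i j (u v : K) : u != 0 -> v != 0 -> (j < p.+1)%N ->
  twodiag i u v * matunit j j.+1
    = (u ^ eps_alpha i j * v ^ eps_alpha i.+1 j)%:M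
      * (matunit j j.+1 * twodiag i u v).
Proof.
move=> u0 v0 jp; apply: twodiag_matunit => //; first exact: ltnW.
by rewrite (expr_eps i j u0) (expr_eps i.+1 j v0); ring.
Qed.

Lemma twodiag_F i j (u v : K) : u != 0 -> v != 0 -> (j < p.+1)%N ->
  twodiag i u v * matunit j.+1 j
    = (u ^ (- eps_alpha i j) * v ^ (- eps_alpha i.+1 j))%:M
      * (matunit j.+1 j * twodiag i u v).
Proof.
move=> u0 v0 jp; apply: twodiag_matunit => //; first exact: ltnW.
rewrite (expr_eps i j u0) (expr_eps i.+1 j v0) -!invr_expz.
by field; rewrite !expfz_neq0.
Qed.
End NaturalRepresentation.

(** Both Serre relations, whatever their coefficients, hold for elements G and H
    of square zero one of whose products vanishes: then every cubic monomial in
    them vanishes. *)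
Lemma rmorph_serre0 (F S : pzRingType) (phi : {rmorphism F -> S}) c d g h G H :
  phi g = G -> phi h = H ->
  G * G = 0 -> H * H = 0 -> G * H = 0 \/ H * G = 0 ->
  phi (g ^+ 2 * h - c * (g * h * g) + d * (h * g ^+ 2)) = 0
  /\ phi (g * h ^+ 2 - c * (h * g * h) + d * (h ^+ 2 * g)) = 0.
Proof.
move=> phig phih G2 H2 GH; rewrite !(rmorphD, rmorphN, rmorphM, rmorphXn) /=.
rewrite phig phih !expr2 G2 H2.
have [-> ->] : G * H * G = 0 /\ H * G * H = 0.
  by case: GH => GH; split; by [rewrite GH mul0r | rewrite -mulrA GH mulr0].
by rewrite !(mulr0, mul0r) subrr addr0.
Qed.

Lemma rmorph_qbracket (F S : pzRingType) (phi : {rmorphism F -> S}) c g h :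
  phi (g * h - c * (h * g)) = phi g * phi h - phi c * (phi h * phi g).
Proof. by rewrite rmorphB !rmorphM. Qed.

(** * The generators e_k are nonzero *)

Section Nonvanishing.
Variables (K : fieldType) (p : nat) (r s : K).
Hypotheses (r0 : r != 0) (s0 : s != 0) (rs : r != s).
Notation M := 'M[K]_p.+2.
Notation U := (Urs p.+2 r s).

(** The natural representation of the quantum group on K^n, n = p + 2. *)
Definition natrep (x : qgen p.+1) : M :=
  match x with
  | GE i => matunit K p i i.+1
  | GF i => matunit K p i.+1 i
  | GW i => twodiag p i r s
  | GWi i => twodiag p i r^-1 s^-1
  | GW' i => twodiag p i s r
  | GW'i i => twodiag p i s^-1 r^-1
  end.

Lemma natrep_Urs :
  exists phi : {rmorphism U -> M},
    (forall c, phi c%:S = c%:M) /\ (forall x, phi (Ugen r s x) = natrep x).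
Proof.
have [phi [phiS phiG]] := freealg_lift (f := @scalar_mx K p.+2) natrep
  (fun c u => esym (scalar_mxC c u)).
have lt1 (i : 'I_p.+1) : (i.+1 < p.+2)%N by rewrite ltnS.
have lt2 (i : 'I_p.+1) : (i < p.+2)%N by rewrite ltnW // ltnS.
have [phiM phiB] := (rmorphM phi, rmorphB phi).
have [phi0 phi1] := (rmorph0 phi, rmorph1 phi).
have phi_rel u v : @Urel K p.+2 r s u v -> phi u = phi v.
  case=> {u v} [x y tx ty|i|i|i j|i j|i j|i j|i j|i j ij|i j ij
    |i j ij|i j ij|i j ij|i j ij];
    (* Forgetting what the generators are keeps unification from unfolding the
       product of the free algebra. *)
    move: (@freegen K _) phiG => gen phiG.
  - rewrite [LHS]phiM phiM 2!phiG.
    by case: x tx => // i _; case: y ty => // j _; apply: twodiagC.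
  - by rewrite [LHS]phiM phi1 2!phiG /= twodiagM !mulfV // twodiag11.
  - by rewrite [LHS]phiM phi1 2!phiG /= twodiagM !mulfV // twodiag11.
  - by rewrite [LHS]phiM 2!phiG phiM phiS phiM 2!phiG; apply: twodiag_E.
  - by rewrite [LHS]phiM 2!phiG phiM phiS phiM 2!phiG; apply: twodiag_F.
  - rewrite [LHS]phiM 2!phiG phiM phiS phiM 2!phiG [r ^ _ * _]mulrC.
    exact: twodiag_E.
  - rewrite [LHS]phiM 2!phiG phiM phiS phiM 2!phiG [r ^ _ * _]mulrC.
    exact: twodiag_F.
  - rewrite [RHS]phiM phiS [phi (_ - _) in RHS]phiB 2!phiG /=.
    transitivity
      (natrep (GE i) * natrep (GF j) - natrep (GF j) * natrep (GE i)).
      by rewrite [LHS]phiB; congr (_ - _); rewrite phiM 2!phiG.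
    rewrite /= !matunitM ?lt1 ?lt2 // eqSS [j == i :> nat]eq_sym.
    rewrite [i == j :> nat]val_eqE; case: eqVneq => [<-|_].
      rewrite twodiag_sub // mulrA -rmorphM /= mul1r mulVf ?subr_eq0 //.
      by rewrite mul1r.
    have -> : false%:R / (r - s) = 0 by exact: mul0r.
    by rewrite -[RHS]/(_ *m _) mul_scalar_mx scale0r subrr.
  - rewrite phi0.
    transitivity
      (natrep (GE i) * natrep (GE j) - natrep (GE j) * natrep (GE i)).
      by rewrite [LHS]phiB; congr (_ - _); rewrite phiM 2!phiG.
    rewrite /= !matunitM0 ?lt1 ?lt2 ?subrr //; move: ij => /=; lia.
  - rewrite phi0.
    transitivity
      (natrep (GF i) * natrep (GF j) - natrep (GF j) * natrep (GF i)).
      by rewrite [LHS]phiB; congr (_ - _); rewrite phiM 2!phiG.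
    rewrite /= !matunitM0 ?lt1 ?lt2 ?subrr //; move: ij => /=; lia.
  - rewrite phi0.
    apply: (rmorph_serre0 _ _ (phiG _) (phiG _) _ _ (or_intror _)).1;
      rewrite /= ?matunitM0 ?lt1 ?lt2 //; move: ij => /=; lia.
  - rewrite phi0.
    apply: (rmorph_serre0 _ _ (phiG _) (phiG _) _ _ (or_intror _)).2;
      rewrite /= ?matunitM0 ?lt1 ?lt2 //; move: ij => /=; lia.
  - rewrite phi0.
    apply: (rmorph_serre0 _ _ (phiG _) (phiG _) _ _ (or_introl _)).1;
      rewrite /= ?matunitM0 ?lt1 ?lt2 //; move: ij => /=; lia.
  - rewrite phi0.
    apply: (rmorph_serre0 _ _ (phiG _) (phiG _) _ _ (or_introl _)).2;
      rewrite /= ?matunitM0 ?lt1 ?lt2 //; move: ij => /=; lia.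
have [psi psiE] := quotalg_lift phi_rel.
exists psi; split=> [c|x]; first exact: etrans (psiE _) (phiS c).
by rewrite /Ugen psiE phiG.
Qed.

Lemma Ue_val (k : nat) (kp : (k < p.+1)%N) :
  @Ue K p.+2 r s k = @Ugen K p.+2 r s (GE (Ordinal kp)).
Proof. by rewrite /Ue insubT. Qed.

Lemma Uf_val (k : nat) (kp : (k < p.+1)%N) :
  @Uf K p.+2 r s k = @Ugen K p.+2 r s (GF (Ordinal kp)).
Proof. by rewrite /Uf insubT. Qed.

Let mx_scalC (c : K) (X : M) : X * c%:M = c%:M * X.
Proof. exact: scalar_mxC. Qed.

Section RootVectors.
Variable phi : {rmorphism U -> M}.
Hypothesis phiS : forall c, phi c%:S = c%:M.
Hypothesis phiG : forall x, phi (@Ugen K p.+2 r s x) = natrep x.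

(** Of the two products in the bracket only E_{j,i} E_{i,i+1} survives, so each
    step of the recursion multiplies the coefficient by - r^-1. *)
Lemma natrep_calE i j : (j <= i < p.+1)%N ->
  exists c : K, phi (calE p.+2 r s i j) = c%:M * matunit K p j i.+1.
Proof.
elim: i => [|i IH] /andP[ji ip] /=.
  exists 1; rewrite mul1r; move: ji; rewrite leqn0 => /eqP->.
  by rewrite Ue_val phiG.
case: ifP => ji'; last first.
  have -> : j = i.+1 by lia.
  by exists 1; rewrite mul1r Ue_val phiG.
have [|c phiE] := IH; first by rewrite ji' ltnW.
exists (- (r^-1 * c)); rewrite rmorph_qbracket phiS phiE Ue_val phiG /=.
have [lt_j lt_i] : (j < p.+2)%N /\ (i.+1 < p.+2)%N by lia.
rewrite (mulrA (matunit K p i.+1 i.+2)) mx_scalC -!mulrA matunitM0 //; last lia.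
by rewrite matunitM // eqxx !mulr0 sub0r mulr1n rmorphN rmorphM mulNr mulrA.
Qed.

(** Here it is the first product, E_{i+1,i} E_{i,j}, that survives. *)
Lemma natrep_calF i j : (j <= i < p.+1)%N ->
  exists c : K, phi (calF p.+2 r s i j) = c%:M * matunit K p i.+1 j.
Proof.
elim: i => [|i IH] /andP[ji ip] /=.
  exists 1; rewrite mul1r; move: ji; rewrite leqn0 => /eqP->.
  by rewrite Uf_val phiG.
case: ifP => ji'; last first.
  have -> : j = i.+1 by lia.
  by exists 1; rewrite mul1r Uf_val phiG.
have [|c phiF] := IH; first by rewrite ji' ltnW.
exists c; rewrite rmorph_qbracket phiS phiF Uf_val phiG /=.
have [lt_j lt_i] : (j < p.+2)%N /\ (i.+1 < p.+2)%N by lia.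
rewrite (mulrA (matunit K p i.+2 i.+1)) mx_scalC -!mulrA.
rewrite matunitM // eqxx mulr1n matunitM0 ?ltnS //; last lia.
by rewrite !mulr0 subr0.
Qed.
End RootVectors.

Lemma scaled_matunit_nilpotent c i j l :
  (i < p.+2)%N -> (j < p.+2)%N -> i != j -> (1 < l)%N ->
  (c%:M * matunit K p i j) ^+ l = 0.
Proof.
move=> ip jp ij; case: l => [|[|l]] // _.
have sq0 : (c%:M * matunit K p i j) ^+ 2 = 0.
  by rewrite expr2 mulrA mx_scalC !mulrA -mulrA matunitM0 ?mulr0 // eq_sym.
by rewrite -(addn2 l) exprD sq0 mulr0.
Qed.

(** The natural representation of the quantum group satisfies the relations of
    the restricted one, and maps e_k to a matrix unit. *)
Lemma ugen_GE_neq0 l (k : 'I_p.+1) :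
  (1 < l)%N -> r ^+ l = 1 -> s ^+ l = 1 ->
  @ugen K p.+2 r s l (GE k) != 0.
Proof.
move=> l1 rl sl; have [phi [phiS phiG]] := natrep_Urs.
have lt1 (i : 'I_p.+1) : (i.+1 < p.+2)%N by rewrite ltnS.
have lt2 (i : 'I_p.+1) : (i < p.+2)%N by rewrite ltnW // ltnS.
have phi_rel u v : @urel K p.+2 r s l u v -> phi u = phi v.
  case=> {u v} [i j ji|i j ji|i|i].
  - have [|c phiE] := natrep_calE phiS phiG (i := i) (j := j).
      by rewrite ji /=.
    rewrite (rmorphXn phi) phiE rmorph0 scaled_matunit_nilpotent //.
    by rewrite ltn_eqF.
  - have [|c phiF] := natrep_calF phiS phiG (i := i) (j := j).
      by rewrite ji /=.
    rewrite (rmorphXn phi) phiF rmorph0 scaled_matunit_nilpotent //.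
    by rewrite gtn_eqF.
  - by rewrite (rmorphXn phi) rmorph1 phiG /= twodiagX rl sl twodiag11.
  - by rewrite (rmorphXn phi) rmorph1 phiG /= twodiagX rl sl twodiag11.
have [psi psiE] := quotalg_lift phi_rel.
apply/eqP => /(congr1 psi); rewrite rmorph0 [psi _]psiE phiG => /eqP.
exact/negP/matunit_neq0.
Qed.
End Nonvanishing.

(** * Group-like elements and the generators *)

Section GrouplikeElements.
Variables (K : fieldType) (n : nat) (r s : K) (l : nat).
Notation m := n.-1.
Notation u := (urs n r s l).
Notation gen := (@ugen K n r s l).

Definition free_proj (x : freealg K (qgen m)) : u :=
  quotpi (@urel K n r s l) (quotpi (@Urel K n r s) x).

Lemma free_projM x y : free_proj (x * y) = free_proj x * free_proj y.
Proof. by rewrite /free_proj !rmorphM. Qed.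

Lemma free_projD x y : free_proj (x + y) = free_proj x + free_proj y.
Proof. by rewrite /free_proj !rmorphD. Qed.

Lemma free_proj1 : free_proj 1 = 1.
Proof. by rewrite /free_proj !rmorph1. Qed.

Lemma free_proj_rel x y : @Urel K n r s x y -> free_proj x = free_proj y.
Proof. by move=> xy; congr quotpi; apply/quotpiP; apply: ideal_rel. Qed.

Lemma free_proj_inv x y :
  @Urel K n r s (x * y) 1 -> free_proj x * free_proj y = 1.
Proof.
move=> xy.
exact (etrans (esym (free_projM x y)) (etrans (free_proj_rel xy) free_proj1)).
Qed.

Lemma free_proj_qcomm c x y : @Urel K n r s (x * y) (c%:S * (y * x)) ->
  qcomm c (free_proj x) (free_proj y).
Proof.
move=> xy.
refine (etrans (esym (free_projM x y)) (etrans (free_proj_rel xy) _)).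
exact (etrans (free_projM c%:S _) (congr1 _ (free_projM y x))).
Qed.

Lemma ugen_toralC x y : toral x -> toral y -> GRing.comm (gen x) (gen y).
Proof.
move=> tx ty; pose gx := freegen K x; pose gy := freegen K y.
refine (etrans (esym (free_projM gx gy)) _).
exact (etrans (free_proj_rel (R1_comm r s tx ty)) (free_projM gy gx)).
Qed.

Lemma ugen_WV (i : 'I_m) : gen (GW i) * gen (GWi i) = 1.
Proof. exact (free_proj_inv (R1_inv r s i)). Qed.

Lemma ugen_W'V (i : 'I_m) : gen (GW' i) * gen (GW'i i) = 1.
Proof. exact (free_proj_inv (R1_inv' r s i)). Qed.

Lemma ugen_WiW (i : 'I_m) : gen (GWi i) * gen (GW i) = 1.
Proof. exact (etrans (@ugen_toralC (GWi i) (GW i) isT isT) (ugen_WV i)). Qed.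

Lemma ugen_W'iW' (i : 'I_m) : gen (GW'i i) * gen (GW' i) = 1.
Proof. exact (etrans (@ugen_toralC (GW'i i) (GW' i) isT isT) (ugen_W'V i)). Qed.

Lemma qcomm_W_E (i k : 'I_m) :
  qcomm (r ^ eps_alpha i k * s ^ eps_alpha i.+1 k) (gen (GW i)) (gen (GE k)).
Proof. exact (free_proj_qcomm (R2_e r s i k)). Qed.

Lemma qcomm_W_F (i k : 'I_m) :
  qcomm (r ^ (- eps_alpha i k) * s ^ (- eps_alpha i.+1 k))
    (gen (GW i)) (gen (GF k)).
Proof. exact (free_proj_qcomm (R2_f r s i k)). Qed.

Lemma qcomm_W'_E (i k : 'I_m) :
  qcomm (r ^ eps_alpha i.+1 k * s ^ eps_alpha i k) (gen (GW' i)) (gen (GE k)).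
Proof. exact (free_proj_qcomm (R3_e r s i k)). Qed.

Lemma qcomm_W'_F (i k : 'I_m) :
  qcomm (r ^ (- eps_alpha i.+1 k) * s ^ (- eps_alpha i k))
    (gen (GW' i)) (gen (GF k)).
Proof. exact (free_proj_qcomm (R3_f r s i k)). Qed.

(** The elements commuting with g form a subalgebra, and the generators generate
    the restricted quantum group as an algebra. *)
Lemma central_ugen (g : u) : (forall x, GRing.comm g (gen x)) -> central g.
Proof.
move=> gC v; rewrite -(quotpi_repr v); move: (repr _) => {v} v.
rewrite -(quotpi_repr v); move: (repr _) => {v} v.
rewrite -/(free_proj v); elim/freealg_ind: v => [c|x|v w gv gw|v w gv gw].
- by symmetry; apply: (@scalC K u c g).
- exact: gC.
- by rewrite free_projD; apply: commrD.
- by rewrite free_projM; apply: commrM.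
Qed.

Lemma intpow_comm (g x xi : u) (d : int) :
  GRing.comm g x -> GRing.comm g xi -> GRing.comm g (intpow x xi d).
Proof. by move=> gx gxi; case: d => k; apply: commrX. Qed.

Lemma intpowV (x xi : u) (d : int) : x * xi = 1 -> xi * x = 1 ->
  intpow x xi d * intpow xi x d = 1.
Proof.
move=> xxi xix.
by case: d => k; [apply: (expr_inv k xxi xix) | apply: (expr_inv k.+1 xix xxi)].
Qed.

Lemma qcomm_intpow (c : K) (x xi v : u) (d : int) :
  c != 0 -> x * xi = 1 -> xi * x = 1 -> qcomm c x v ->
  qcomm (c ^ d) (intpow x xi d) v.
Proof.
move=> c0 xxi xix xv; case: d => k; first exact (qcommX k xv).
rewrite NegzE -exprz_inv; exact (qcommX k.+1 (qcommV c0 xxi xix xv)).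
Qed.

Variables a b : 'cV[int]_m.

Lemma intpow_invertible (x xi : u) (d : int) : x * xi = 1 -> xi * x = 1 ->
  invertible (intpow x xi d).
Proof.
by move=> xxi xix; exists (intpow xi x d); split; apply: intpowV.
Qed.

Lemma grouplike_invertible : invertible (grouplike r s l a b).
Proof.
apply: invertibleM; apply: invertible_prod => i; apply: intpow_invertible.
- exact: ugen_WV.
- exact: ugen_WiW.
- exact: ugen_W'V.
- exact: ugen_W'iW'.
Qed.

Lemma grouplike_toralC x : toral x -> GRing.comm (grouplike r s l a b) (gen x).
Proof.
move=> tx; apply: commr_sym; apply: commrM; apply: commr_prod => i _;
  by apply: intpow_comm; apply: ugen_toralC.
Qed.

(** The scalars of the factors multiply, so their exponents, weighted by those
    of g, add up. *)
Lemma qcomm_grouplike (theta : K) (v : u) (cW cW' : 'I_m -> int) :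
  theta != 0 ->
  (forall i, qcomm (theta ^ cW i) (gen (GW i)) v) ->
  (forall i, qcomm (theta ^ cW' i) (gen (GW' i)) v) ->
  qcomm (theta ^ (\sum_i cW i * a i 0 + \sum_i cW' i * b i 0))
    (grouplike r s l a b) v.
Proof.
move=> th0 Wv W'v.
have -> : theta ^ (\sum_i cW i * a i 0 + \sum_i cW' i * b i 0)
    = \prod_i theta ^ (cW i * a i 0) * \prod_i theta ^ (cW' i * b i 0).
  by rewrite expfzDr // !prod_exprz.
apply: qcommM; apply: qcomm_prod => i; rewrite -exprz_exp;
  apply: qcomm_intpow; rewrite ?expfz_neq0 //.
- exact: ugen_WV.
- exact: ugen_WiW.
- exact: ugen_W'V.
- exact: ugen_W'iW'.
Qed.

Variables (theta : K) (y z : nat).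
Hypotheses (th0 : theta != 0).
Hypotheses (r_theta : r = theta ^+ y) (s_theta : s = theta ^+ z).
Let A := tridiag m y%:Z z%:Z.
Let d (k : 'I_m) : int := (A^T *m a - A *m b) k 0.

Lemma expr_rs e1 e2 : r ^ e1 * s ^ e2 = theta ^ (y%:Z * e1 + z%:Z * e2).
Proof. by rewrite r_theta s_theta !exprnP !exprz_exp expfzDr. Qed.

Lemma qcomm_grouplike_E k :
  qcomm (theta ^ d k) (grouplike r s l a b) (gen (GE k)).
Proof.
have -> : d k = \sum_i A i k * a i 0 + \sum_i (- A k i) * b i 0.
  rewrite /d !mxE -sumrN; congr (_ + _); apply: eq_bigr => i _.
    by rewrite mxE.
  by rewrite mulNr.
apply: (qcomm_grouplike th0) => i.
  by rewrite -eps_alpha_tridiag -expr_rs; apply: qcomm_W_E.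
by rewrite -eps_alpha_tridiag_trans -expr_rs; apply: qcomm_W'_E.
Qed.

Lemma qcomm_grouplike_F k :
  qcomm (theta ^ (- d k)) (grouplike r s l a b) (gen (GF k)).
Proof.
have -> : - d k = \sum_i (- A i k) * a i 0 + \sum_i A k i * b i 0.
  rewrite /d !mxE opprB addrC -sumrN; congr (_ + _).
  by apply: eq_bigr => i _; rewrite mxE mulNr.
apply: (qcomm_grouplike th0) => i.
  rewrite -eps_alpha_tridiag opprD -!mulrN -expr_rs; exact: qcomm_W_F.
rewrite -[A k i]opprK -eps_alpha_tridiag_trans opprD -!mulrN -expr_rs.
exact: qcomm_W'_F.
Qed.

(** A central g forces theta^d_k = 1 because e_k is nonzero and g invertible;
    conversely, these equations give the commutation with the f_k as well, whose
    scalars are the inverses of those of the e_k. *)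
Lemma central_grouplikeP : (forall k, gen (GE k) != 0) ->
  central (grouplike r s l a b) <-> forall k, theta ^ d k = 1.
Proof.
move=> e0; split=> [gC k|d1].
  apply/eqP; apply: contraNT (e0 k) => dk1; apply/eqP.
  exact (qcomm_comm_eq0 (qcomm_grouplike_E k) (gC _) grouplike_invertible dk1).
apply: central_ugen => -[k|k|k|k|k|k]; try exact: grouplike_toralC.
  by apply: qcomm1_comm; rewrite -(d1 k); apply: qcomm_grouplike_E.
apply: qcomm1_comm; rewrite -[1]invr1 -(d1 k) invr_expz.
exact: qcomm_grouplike_F.
Qed.
End GrouplikeElements.

(** * The criterion for centrality *)

Theorem proposition2p4 (K : closedFieldType) (n : nat)
    (ord_r ord_s l y z : nat) (r s theta : K) (a b : 'cV[int]_n.-1) :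
  [pchar K] =i pred0 ->
  (2 <= n)%N ->
  ord_r.-primitive_root r ->
  ord_s.-primitive_root s ->
  r != s ->
  l = lcmn ord_r ord_s ->
  l.-primitive_root theta ->
  r = theta ^+ y ->
  s = theta ^+ z ->
  gcdz (\sum_(i < n) (-1) ^+ i * y%:Z ^+ (n.-1 - i) * z%:Z ^+ i) l%:Z = 1 ->
  let A : 'M['Z_l]_n.-1 := map_mx intr (tridiag n.-1 y%:Z z%:Z) in
  let abar : 'cV['Z_l]_n.-1 := map_mx intr a in
  let bbar : 'cV['Z_l]_n.-1 := map_mx intr b in
  central (@grouplike K n r s l a b) <-> bbar = invmx A *m A^T *m abar.
Proof.
move=> _ n2 _ _ rs _ th rE sE gcd1 A abar bbar.
have [p np] : exists p, n = p.+2.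
  by case: n n2 {a b gcd1 A abar bbar} => [|[|p]] // _; exists p.
subst n.
have l1 : (1 < l)%N.
  have l0 := prim_order_gt0 th; rewrite ltn_neqAle l0 andbT eq_sym.
  apply: contraNneq rs => l1; have := prim_expr_order th.
  by rewrite l1 expr1 rE sE => ->; rewrite !expr1n.
have th0 : theta != 0.
  apply/eqP=> th0; have := prim_expr_order th.
  rewrite th0 expr0n gtn_eqF ?(ltnW l1) //.
  by move/esym/eqP; rewrite oner_eq0.
have powl k : (theta ^+ k) ^+ l = 1.
  by rewrite -exprM mulnC exprM (prim_expr_order th) expr1n.
have e0 k : @ugen K p.+2 r s l (GE k) != 0.
  by apply: ugen_GE_neq0 => //; rewrite ?rE ?sE ?expf_neq0 ?powl // -rE -sE.
have Au : A \in unitmx by exact: tridiag_unitmx.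
apply: iff_trans (central_grouplikeP a b th0 rE sE e0) _.
have dE : A^T *m abar - A *m bbar
    = map_mx intr ((tridiag p.+1 y z)^T *m a - tridiag p.+1 y z *m b).
  by rewrite map_mxB !map_mxM map_trmx.
split=> [d1|bE].
  have d0 : A^T *m abar = A *m bbar.
    apply/eqP; rewrite -subr_eq0 dE; apply/eqP/matrixP=> i j.
    rewrite mxE [RHS]mxE ord1; apply/eqP.
    by rewrite -(prim_exprz_eq1 _ th l1) d1.
  by rewrite -mulmxA d0 mulKmx.
move=> k; apply/eqP; rewrite (prim_exprz_eq1 _ th l1).
have : A^T *m abar - A *m bbar = 0.
  by rewrite bE -mulmxA mulKVmx // subrr.
by rewrite dE => /matrixP/(_ k 0); rewrite mxE [RHS]mxE => ->.
Qed.
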